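(* Let $|q|<1$ and define integers $a_n,b_n$ by $$\sum_{n=0}^{\infty}a_nq^n=(-q,-q^4;q^5)_\infty(q,q^9;q^{10})_\infty^3,\qquad \sum_{n=0}^{\infty}b_nq^n=(-q^2,-q^3;q^5)_\infty(q^3,q^7;q^{10})_\infty^3,$$ with the convention $a_n=0$ for $n<0$. Then $$\sum_{n=0}^{\infty}b_{5n}q^n-\sum_{n=1}^{\infty}a_{5n-2}q^n=\frac{f_1^4}{f_2^4},$$ and for all $n\ge 0$, $$b_{5n+1}=a_{5n-1},\quad b_{5n+2}=a_{5n},\quad b_{5n+3}=a_{5n+1},\quad b_{5n+4}=a_{5n+2}.$$
   Context: For complex $a$ and $|q|<1$, $(a;q)_\infty=\prod_{k=0}^{\infty}(1-aq^k)$ and $(a_1,\dots,a_m;q)_\infty=(a_1;q)_\infty\cdots(a_m;q)_\infty$. For a positive integer $k$, $f_k:=(q^k;q^k)_\infty$. *)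

(* Defs.v *)
From HB Require Import structures.
From mathcomp Require Import all_boot all_order all_algebra.
From mathcomp Require Import complex.
From mathcomp Require Import all_classical all_reals all_analysis.

Set Implicit Arguments.
Unset Strict Implicit.
Unset Printing Implicit Defensive.

Import Order.TTheory GRing.Theory Num.Theory.
Import numFieldNormedType.Exports.

Local Open Scope classical_set_scope.
Local Open Scope ring_scope.
Local Open Scope complex_scope.

(* R[i] seen as a numFieldType, so that it carries the topology of its modulus
   given by numFieldNormedType. *)
Definition Cplx (R : realType) : numFieldType := R[i].

(* For K = Cplx R and `|q| < 1 this limit exists for every z. *)
Definition qpoch (K : numFieldType) (z q : K) : K :=
  limn (fun n : nat => \prod_(0 <= k < n) (1 - z * q ^+ k)).

Definition qpochs (K : numFieldType) (zs : seq K) (q : K) : K :=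
  \prod_(z <- zs) qpoch z q.

Definition eulerf (K : numFieldType) (k : nat) (q : K) : K :=
  qpoch (q ^+ k) (q ^+ k).

(* Main.v *)
Require Import Defs.
From HB Require Import structures.
From mathcomp Require Import all_boot all_order all_algebra.
From mathcomp Require Import complex.
From mathcomp Require Import all_classical all_reals all_analysis.
From mathcomp Require Import zify ring lra.

Set Implicit Arguments.
Unset Strict Implicit.
Unset Printing Implicit Defensive.

Import Order.TTheory GRing.Theory Num.Theory.
Import numFieldNormedType.Exports.

Local Open Scope classical_set_scope.
Local Open Scope ring_scope.
Local Open Scope complex_scope.

(** Put [T_i = (q^i, q^(10-i); q^10)].  Since [(-q, -q^4; q^5) = T_2 / (T_1 T_4)]
and [(-q^2, -q^3; q^5) = T_4 / (T_2 T_3)], all the assertions say that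
[sum_n (b_n - a_(n-2)) q^n] is the power series [f_5^4 / f_10^4] in [q^5], that is
[T_4^2 T_3^2 - q^2 T_1^2 T_2^2 = T_5^2 T_2 T_4].

For this instance of the Weierstrass addition formula, the triple product writes
[T_i] as a theta series, and the substitution [(j, k) -> (j + k - 1, j - k)] writes
[T_i T_l] as a 2x2 determinant in the even and odd parts of two such series; the
identity is then a Pluecker relation.  To avoid infinite double sums this is done
for the finite products modulo [X^(10n)], by computing in a ring where [X] is
nilpotent.  A coefficientwise majorant on a slightly larger circle shows that
a remainder divisible by [X^(10n-18)] vanishes in the limit.

The coefficients outside the multiples of 5 vanish because the sum is invariant
under [q -> zeta q] with [zeta^5 = 1]. *)

(** * Gaussian binomials and the q-binomial theorem *)

(** The Gaussian binomial is given by its Pascal rule rather than as a quotient, so that it makes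
    sense in rings with nilpotent elements. *)
Fixpoint qbin (A : comNzRingType) (p : A) (n k : nat) : A :=
  match n, k with
  | _, 0 => 1
  | 0, _.+1 => 0
  | n'.+1, k'.+1 => p ^+ k * qbin p n' k + qbin p n' k'
  end.

Lemma qbin0 (A : comNzRingType) (p : A) n : qbin p n 0 = 1.
Proof. by case: n. Qed.

Lemma qbin_small (A : comNzRingType) (p : A) n k : (n < k)%N -> qbin p n k = 0.
Proof.
elim: n k => [|n IHn] [|k] //= nk.
by rewrite !IHn ?mulr0 ?addr0 //; lia.
Qed.

(** Induction peeling off the factor [k = 0]: the other factors form the product for [x * p]. The
    homogeneous variable [y] later takes the value [X^(10n)], which avoids negative powers. *)
Lemma qbinomial_thm (A : comNzRingType) (p x y : A) n :
  \prod_(k < n) (y + x * p ^+ k) =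
  \sum_(j < n.+1) qbin p n j * p ^+ 'C(j, 2) * x ^+ j * y ^+ (n - j).
Proof.
elim: n x => [|n IHn] x.
  by rewrite big_ord0 big_ord1 /= !expr0 !mulr1.
rewrite big_ord_recl /= expr0 mulr1.
under eq_bigr => i _ do rewrite /bump /= add1n exprS mulrA.
rewrite IHn mulrDl !mulr_sumr.
rewrite big_ord_recl [RHS]big_ord_recl /= qbin0 !expr0 /= subn0.
under [X in _ = _ + X]eq_bigr => i _.
  rewrite /bump /= add1n subSS !mulrDl.
  over.
rewrite big_split /= -!addrA; congr (_ + _).
  by rewrite subn0 exprS; ring.
congr (_ + _).
  rewrite [RHS]big_ord_recr /= qbin_small // !mulr0 !mul0r addr0.
  apply: eq_bigr => i _; rewrite /bump /= add1n.
  have -> : (n - i = (n - i.+1).+1)%N by have := ltn_ord i; lia.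
  by rewrite exprMn !exprS; ring.
apply: eq_bigr => i _.
by rewrite binS bin1 exprD exprMn !exprS; ring.
Qed.

Definition qfact (A : comNzRingType) (p : A) n : A :=
  \prod_(k < n) (1 - p ^+ k.+1).

Lemma qfactS (A : comNzRingType) (p : A) n :
  qfact p n.+1 = qfact p n * (1 - p ^+ n.+1).
Proof. by rewrite /qfact big_ord_recr. Qed.

(** Division-free quotient formula. The Pascal rule matches it because [1 - p^(j+m+2) = (1 -
    p^(m+1)) p^(j+1) + (1 - p^(j+1))]. *)
Lemma qbin_qfact (A : comNzRingType) (p : A) j m :
  qbin p (j + m) j * qfact p j * qfact p m = qfact p (j + m).
Proof.
move: {2}(j + m)%N (erefl (j + m)%N) => n.
elim: n j m => [|n IHn] [|j] [|m] //; rewrite ?addn0 ?add0n => E //.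
- by rewrite /qfact big_ord0 qbin0 !mulr1.
- by rewrite qbin0 [qfact p 0]big_ord0 !mul1r.
- rewrite /= qbin_small // mulr0 add0r !qfactS [qfact p 0]big_ord0 mulr1.
  have := IHn j 0%N; rewrite addn0 [qfact p 0]big_ord0 mulr1 mulrA => -> //; lia.
have E1 : qbin p (j + m.+1) j * qfact p j * qfact p m.+1 = qfact p (j + m.+1).
  by apply: IHn; lia.
have E2 : qbin p (j + m.+1) j.+1 * qfact p j.+1 * qfact p m =
    qfact p (j + m.+1).
  by rewrite -addSnnS; apply: IHn; lia.
rewrite addSn [qbin p _.+1 _]/=.
transitivity ((1 - p ^+ m.+1) * p ^+ j.+1 *
    (qbin p (j + m.+1) j.+1 * qfact p j.+1 * qfact p m) +
    (1 - p ^+ j.+1) * (qbin p (j + m.+1) j * qfact p j * qfact p m.+1)).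
  by rewrite !qfactS; ring.
by rewrite E1 E2 qfactS [p ^+ (_ + _).+1]exprS exprD !exprS; ring.
Qed.

(** * Finite form of the Jacobi triple product *)

(** Truncation of [T_i], for a generic [x]: it is used at an indeterminate, at a nilpotent element
    and at a complex number. *)
Definition theta_prod (A : comNzRingType) (x : A) (i n : nat) : A :=
  \prod_(k < n) ((1 - x ^+ (i + 10 * k)) * (1 - x ^+ (10 - i + 10 * k))).

(** Exponent in [T_i (q^10; q^10) = sum_t (-1)^t q^(5t(t-1)+it)]. It is nonnegative for
    [0 <= i <= 10] and every integer [t], so [absz] loses nothing there. *)
Definition theta_exp (i : nat) (t : int) : nat :=
  absz (5%:Z * t * (t - 1) + i%:Z * t).

Lemma theta_expE i t : (i <= 10)%N ->
  (theta_exp i t)%:Z = 5%:Z * t * (t - 1) + i%:Z * t.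
Proof.
move=> i10; rewrite /theta_exp gez0_abs //.
have h : 0 <= t * (t - 1) by have [|] := leP 1 t; nia.
have [t0|t0] := leP 0 t; first by nia.
have : 0 <= (- t - 1) * (- t) by nia.
have : 0 <= (10%:Z - i%:Z) * (- t) by nia.
by nia.
Qed.

Lemma bin2_int n : (2%N * 'C(n, 2))%:Z = n%:Z * (n%:Z - 1).
Proof. by elim: n => [//|n IHn]; rewrite binS bin1; lia. Qed.

Lemma sum_arith_prog i n : (\sum_(k < n) (i + 10 * k) = i * n + 10 * 'C(n, 2))%N.
Proof.
elim: n => [|n IHn]; first by rewrite big_ord0 muln0.
by rewrite big_ord_recr /= IHn binS bin1; lia.
Qed.

(** The q-binomial theorem with [2n] factors, [p = X^10], [x = -X^i], [y = X^(10n)]. The first [n]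
    factors are [-X^(i+10k)] times factors of the second kind in reverse order, the last [n] are
    [X^(10n)] times those of the first kind. The common monomial cancels in a polynomial ring over a
    field. *)
Lemma finite_jacobi_triple_product (F : fieldType) i n : (i <= 10)%N ->
  theta_prod ('X : {poly F}) i n =
  \sum_(j < (2 * n).+1) (-1) ^+ (n + j) * qbin ('X^10) (2 * n) j
     * 'X^(theta_exp i (j%:Z - n%:Z)).
Proof.
move=> i10.
(* [M] is the degree pulled out: [i n + 10 C(n,2)] from the first half of the factors and [10 n n]
   from the second. *)
set M := (i * n + 10 * 'C(n, 2) + 10 * n * n)%N.
have M0 : (-1) ^+ n * 'X^M != 0 :> {poly F}.
  by rewrite mulf_neq0 // ?signr_eq0 // -size_poly_eq0 size_polyXn.
apply: (mulfI M0).
have := qbinomial_thm ('X^10 : {poly F}) (- 'X^i) ('X^(10 * n)) (2 * n).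
have -> : \prod_(k < 2 * n) ('X^(10 * n) + - 'X^i * 'X^10 ^+ k) =
    (-1) ^+ n * 'X^M * theta_prod ('X : {poly F}) i n.
  rewrite mulSn mul1n big_split_ord /= /theta_prod big_split /=.
  have -> : \prod_(k < n) ('X^(10 * n) + - 'X^i * 'X^10 ^+ k) =
      (-1) ^+ n * 'X^(i * n + 10 * 'C(n, 2))
        * \prod_(k < n) (1 - 'X^(10 - i + 10 * k)) :> {poly F}.
    rewrite -sum_arith_prog expr_sum.
    rewrite -[X in (-1) ^+ X]card_ord -prodr_const -big_split /=.
    rewrite [X in _ * X](reindex_inj rev_ord_inj) -big_split /=.
    apply: eq_bigr => k _.
    have -> : (10 * n = (i + 10 * k) + (10 - i + 10 * (n - k.+1)))%N.
      by have := ltn_ord k; lia.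
    rewrite -exprM; move: (10 * k)%N (10 * (n - k.+1))%N => u v.
    by rewrite !exprD; ring.
  have -> : \prod_(k < n) ('X^(10 * n) + - 'X^i * 'X^10 ^+ (n + k)) =
      'X^(10 * n * n) * \prod_(k < n) (1 - 'X^(i + 10 * k)) :> {poly F}.
    have -> : 'X^(10 * n * n) = \prod_(k < n) 'X^(10 * n) :> {poly F}.
      by rewrite prodr_const card_ord exprM.
    rewrite -big_split /=.
    apply: eq_bigr => k _.
    rewrite -exprM mulnDr; move: (10 * n)%N (10 * k)%N => u v.
    by rewrite !exprD; ring.
  rewrite /M; move: (i * n + _)%N (10 * n * n)%N => u v.
  by rewrite !exprD; ring.
move=> ->; rewrite mulr_sumr; apply: eq_bigr => j _.
have E : 'X^10 ^+ 'C(j, 2) * (- 'X^i) ^+ j * 'X^(10 * n) ^+ (2 * n - j) =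
    (-1) ^+ j * 'X^(M + theta_exp i (j%:Z - n%:Z)) :> {poly F}.
  have -> : (M + theta_exp i (j%:Z - n%:Z) =
      10 * 'C(j, 2) + i * j + 10 * n * (2 * n - j))%N.
    apply/eqP; rewrite -eqz_nat PoszD theta_expE // /M; apply/eqP.
    have := bin2_int n; have := bin2_int j; have := ltn_ord j.
    by nia.
  rewrite [(- 'X^i) ^+ j]exprNn -!exprM.
  move: (10 * 'C(j, 2))%N (i * j)%N (10 * n * _)%N => u v w.
  by rewrite !exprD; ring.
move: E; set u := _ ^+ 'C(j, 2); set v := (- 'X^i) ^+ j; set w := _ ^+ (2 * n - j).
move=> E; rewrite -[LHS]mulrA -[_ * u * _]mulrA [u * _]mulrA E.
move: (theta_exp _ _) => e; rewrite ['X^(M + e)]exprD [(-1) ^+ (n + j)]exprD.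
have sgn : (-1) ^+ n * (-1) ^+ n = 1 :> {poly F} by rewrite -expr2 sqrr_sign.
move: sgn; move: ((-1) ^+ n) ('X^M) ('X^e) ((-1) ^+ j) => c a d f sgn.
transitivity (c * c * (qbin ('X^10) (2 * n) j * (f * (a * d)))); last by ring.
by rewrite sgn mul1r.
Qed.

(** * The triple product modulo a power of [X] *)

Lemma rmorph_qbin (A B : comNzRingType) (phi : {rmorphism A -> B}) p n k :
  phi (qbin p n k) = qbin (phi p) n k.
Proof.
elim: n k => [|n IHn] [|k] //=; rewrite ?rmorph1 ?rmorph0 //.
by rewrite rmorphD rmorphM rmorphXn /= !IHn.
Qed.

Lemma rmorph_theta_prod (A B : comNzRingType) (phi : {rmorphism A -> B}) x i n :
  phi (theta_prod x i n) = theta_prod (phi x) i n.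
Proof.
rewrite rmorph_prod; apply: eq_bigr => k _.
by rewrite rmorphM !rmorphB !rmorphXn rmorph1.
Qed.

Lemma expr_nilp (A : comNzRingType) (x : A) N m :
  x ^+ N = 0 -> (N <= m)%N -> x ^+ m = 0.
Proof. by move=> xN /subnK <-; rewrite exprD xN mulr0. Qed.

(** Iterating [z = x y z] brings in [x ^+ N = 0]. *)
Lemma nilp_cancel (A : comNzRingType) (x y z : A) N :
  x ^+ N = 0 -> (1 - x * y) * z = 0 -> z = 0.
Proof.
move=> xN; rewrite mulrBl mul1r => /eqP; rewrite subr_eq0 => /eqP zE.
suff -> : z = (x * y) ^+ N * z by rewrite exprMn xN !mul0r.
by elim: N {xN} => [|N IHN]; rewrite ?expr0 ?mul1r // exprSr -mulrA -zE.
Qed.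

Lemma qfact_cancel (A : comNzRingType) (x z : A) N n :
  x ^+ N = 0 -> qfact x n * z = 0 -> z = 0.
Proof.
move=> xN; elim: n z => [|n IHn] z; first by rewrite /qfact big_ord0 mul1r.
rewrite qfactS -mulrA => /IHn; rewrite exprS; exact: nilp_cancel xN.
Qed.

Lemma qfact_annihilated (A : comNzRingType) (p y : A) k m :
  (k <= m)%N -> p ^+ k.+1 * y = 0 -> qfact p m * y = qfact p k * y.
Proof.
move=> /subnK <- yk; elim: (m - k)%N => [//|d IHd].
rewrite addSn qfactS -mulrA mulrBl mul1r.
have -> : p ^+ (d + k).+1 * y = 0 by rewrite -addnS exprD -mulrA yk mulr0.
by rewrite subr0.
Qed.

(** Since [p^(k+1)] kills [y], the factorials of [k], [n], [K] and [2n] all act alike on [y]. One of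
    them cancels from the quotient formula for the binomial, which leaves
    [qfact p n * qbin p (2 * n) j] acting as the identity. *)
Lemma qbin_qfact_annihilated (A : comNzRingType) (p y : A) N n k K j :
  p ^+ N = 0 -> (k + K = 2 * n)%N -> (k <= K)%N -> j = k \/ j = K ->
  p ^+ k.+1 * y = 0 -> qfact p n * qbin p (2 * n) j * y = y.
Proof.
move=> pN kK lekK jk yk.
have qE : qbin p (2 * n) j * qfact p k * qfact p K = qfact p (2 * n).
  case: jk => ->; rewrite -kK; first exact: qbin_qfact.
  by rewrite addnC mulrAC qbin_qfact.
have : qfact p k * (qfact p k * qbin p (2 * n) j * y - y) = 0.
  have E1 : qfact p K * y = qfact p k * y by apply: qfact_annihilated.
  have E2 : qfact p (2 * n) * y = qfact p k * y.
    by apply: qfact_annihilated => //; lia.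
  rewrite mulrBr -E2 -qE.
  have -> : qfact p k * (qfact p k * qbin p (2 * n) j * y) =
      qfact p k * qbin p (2 * n) j * (qfact p k * y) by ring.
  by rewrite -E1; ring.
move=> /(qfact_cancel pN) /eqP; rewrite subr_eq0 => /eqP {2}<-.
rewrite mulrAC [RHS]mulrAC; congr (_ * _).
by apply: qfact_annihilated => //; lia.
Qed.

Definition theta_sum (A : comNzRingType) (x : A) (i n : nat) : A :=
  \sum_(j < (2 * n).+1) (-1) ^+ (n + j) * x ^+ theta_exp i (j%:Z - n%:Z).

(** For [t = j - n], the binomial differs from its limit only from degree [10(n - |t| + 1)] on.
    Adding the exponent of the [j]-th term gives at least [10n], where all powers vanish. *)
Lemma jacobi_triple_product_trunc (F : fieldType) (A : comNzRingType)
    (phi : {rmorphism {poly F} -> A}) i n :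
  phi 'X ^+ (10 * n) = 0 -> (0 < i < 10)%N ->
  qfact (phi 'X ^+ 10) n * theta_prod (phi 'X) i n = theta_sum (phi 'X) i n.
Proof.
move=> xN i10; rewrite -rmorph_theta_prod finite_jacobi_triple_product; last by lia.
rewrite rmorph_sum mulr_sumr; apply: eq_bigr => j _.
rewrite !rmorphM rmorph_qbin !rmorphXn rmorphN1 /=.
set x := phi 'X in xN *; set e := theta_exp _ _.
rewrite mulrA [_ * ((-1) ^+ _ * _)]mulrCA -mulrA; congr (_ * _).
have eE : e%:Z = 5%:Z * (j%:Z - n%:Z) * (j%:Z - n%:Z - 1) + i%:Z * (j%:Z - n%:Z).
  by apply: theta_expE; lia.
have jn := ltn_ord j.
have [jln|nlj] := leqP j n.
  apply: (@qbin_qfact_annihilated _ (x ^+ 10) _ n n j (2 * n - j)).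
  - by rewrite -exprM.
  - lia.
  - lia.
  - by left.
  - rewrite -exprM -exprD; apply: (expr_nilp xN).
    have [|] := leqP j.+1 n; last by nia.
    have [|] := leqP j.+2 n; last by nia.
    by nia.
apply: (@qbin_qfact_annihilated _ (x ^+ 10) _ n n (2 * n - j) j).
- by rewrite -exprM.
- lia.
- lia.
- by right.
- rewrite -exprM -exprD; apply: (expr_nilp xN).
  have [t jE] : exists t, j = (n + t.+1)%N :> nat by exists (j - n.+1)%N; lia.
  have tE : j%:Z - n%:Z = t%:Z + 1 by lia.
  rewrite tE in eE; have : 0 <= i%:Z * t%:Z by [].
  have : 0 <= t%:Z * (t%:Z - 1) by case: (t) => [//|u]; lia.
  by lia.
Qed.

(** * Products of two theta series as determinants *)

(* The shift by [4] makes the exponent nonnegative for [h <= 9]; for odd [h] the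
   halving is exact. *)
Definition half_exp (h : nat) (s : int) : nat :=
  (absz (5%:Z * s * s + h%:Z * s + 4%:Z))./2.

Lemma half_expE h s : odd h -> (h <= 9)%N ->
  (2 * half_exp h s)%:Z = 5%:Z * s * s + h%:Z * s + 4%:Z.
Proof.
move=> hodd h9; rewrite /half_exp.
have pos : 0 <= 5%:Z * s * s + h%:Z * s + 4%:Z.
  have [s0|s0] := leP 0 s; first by nia.
  have : 0 <= (9%:Z - h%:Z) * (- s) by nia.
  (* The product equals [5s^2 + 9s + 4], the extreme case [h = 9] for negative [s]; the previous
     line bounds the difference for smaller [h]. *)
  have : 0 <= (- s - 1) * (- 5%:Z * s - 4%:Z) by nia.
  by nia.
have [t E] : exists t : int, 5%:Z * s * s + h%:Z * s + 4%:Z = 2%:Z * t.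
  have [r hE] : exists r, h = (2 * r + 1)%N by exists (h./2); lia.
  have [u [sE|sE]] : exists u : int, s = 2%:Z * u \/ s = 2%:Z * u + 1.
    by exists (s %/ 2)%Z; lia.
  - by exists (10%:Z * u * u + h%:Z * u + 2%:Z); rewrite sE; ring.
  exists (10%:Z * u * u + 10%:Z * u + 3%:Z + h%:Z * u + r%:Z + 2%:Z).
  by rewrite sE hE; lia.
by rewrite E in pos *; lia.
Qed.

Lemma theta_exp_lb i n t : (0 < i < 10)%N -> (n%:Z < t \/ t < - n%:Z) ->
  (10 * n <= theta_exp i t)%N.
Proof.
move=> i10 tn; suff : (10 * n)%:Z <= (theta_exp i t)%:Z by [].
rewrite theta_expE; last by lia.
case: tn => tn.
  have : 0 <= (t - n%:Z - 1) * t by nia.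
  have : 0 <= (i%:Z - 1) * t by nia.
  have [|] := leP 2%:Z n%:Z; nia.
have : 0 <= (- t - n%:Z - 1) * (- t) by nia.
have : 0 <= (9%:Z - i%:Z) * (- t) by nia.
have [|] := leP 2%:Z n%:Z; nia.
Qed.

(** Under [s = j + k - 1], [d = j - k] the quadratic form separates, since
    [2(j^2 + k^2) = (s+1)^2 + d^2]. The [9] and [m] absorb the constants, including the two shifts
    by [4], within natural numbers. *)
Lemma half_exp_theta_exp i l m (j k s d : int) :
  (0 < l < i)%N -> (i < 10)%N -> (i + l <= 9)%N -> odd (i + l) ->
  (2 * m = i + l + 5)%N -> s + 1 = j + k -> d = j - k ->
  (m + half_exp (i + l) s + half_exp (i - l) d = 9 + theta_exp i j + theta_exp l k)%N.
Proof.
move=> li i10 il9 ilodd mE sE dE.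
have := @half_expE (i + l) s ilodd il9.
have := @half_expE (i - l) d _ _.
have := @theta_expE i j _; have := @theta_expE l k _.
move=> /(_ ltac:(lia)) E1 /(_ ltac:(lia)) E2 /(_ ltac:(lia) ltac:(lia)) E3 E4.
have ilE : (i - l)%:Z = i%:Z - l%:Z by lia.
have ilE' : (i + l)%:Z = i%:Z + l%:Z by lia.
have sE' : s = j + k - 1 by lia.
rewrite ilE dE in E3; rewrite ilE' sE' in E4.
rewrite sE' dE.
move: E1 E2 E3 E4.
move: (theta_exp _ _) (theta_exp _ _) (half_exp _ _) (half_exp _ _).
by move=> a b c e E1 E2 E3 E4; nia.
Qed.

(** The true index is [s - (2n + 2)]; the shift is even, so it preserves parity. The window contains
    every [j + k - 1] and [j - k] with [|j|, |k| <= n]. *)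
Definition parity_sum (A : comNzRingType) (x : A) (n : nat) (b : bool) (h : nat) : A :=
  \sum_(s < 4 * n + 5 | odd s == b) x ^+ half_exp h (s%:Z - (2 * n + 2)%:Z).

Definition parity_det (A : comNzRingType) (x : A) (n h k : nat) : A :=
  parity_sum x n true h * parity_sum x n false k
  - parity_sum x n false h * parity_sum x n true k.

Lemma parity_detE (A : comNzRingType) (x : A) n h k :
  parity_det x n h k =
  \sum_(p : 'I_(4 * n + 5) * 'I_(4 * n + 5) | odd p.1 != odd p.2)
    (-1) ^+ p.1.+1 * (x ^+ half_exp h (p.1%:Z - (2 * n + 2)%:Z)
      * x ^+ half_exp k (p.2%:Z - (2 * n + 2)%:Z)).
Proof.
rewrite /parity_det /parity_sum !big_distrlr /= !pair_big_dep /=.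
rewrite [RHS](bigID (fun p : 'I_(4 * n + 5) * 'I_(4 * n + 5) => odd p.1)) /=.
congr (_ + _); last rewrite -sumrN.
  apply: eq_big => [p|p /andP[/eqP p1 _]]; first by case: (odd p.1) (odd p.2) => -[].
  by rewrite exprS -signr_odd p1 expr1; ring.
apply: eq_big => [p|p /andP[/eqP p1 _]]; first by case: (odd p.1) (odd p.2) => -[].
by rewrite exprS -signr_odd p1 expr0; ring.
Qed.

(** The substitution [(j, k) -> (j + k - 1, j - k)] is a bijection onto pairs of opposite parity,
    which are exactly the terms of the determinant, and [(-1)^(j+k)] becomes its sign. Pairs of the
    window with [|j| > n] or [|k| > n] have exponent at least [10n] and vanish. *)
Lemma theta_sum_mul (A : comNzRingType) (x : A) n i l m :
  x ^+ (10 * n) = 0 ->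
  (0 < l < i)%N -> (i < 10)%N -> (i + l <= 9)%N -> odd (i + l) ->
  (2 * m = i + l + 5)%N ->
  x ^+ 9 * (theta_sum x i n * theta_sum x l n) =
  x ^+ m * parity_det x n (i + l) (i - l).
Proof.
move=> xN li i10 il9 ilodd mE.
rewrite parity_detE /theta_sum big_distrlr pair_big /= !mulr_sumr.
set L := (2 * n + 2)%N; have LE : L = (2 * n + 2)%N by [].
clearbody L.
(* The four inequalities say [-n <= j <= n] and [-n <= k <= n] for the preimage [(j, k)] of the
   pair. *)
pose inside (p : 'I_(4 * n + 5) * 'I_(4 * n + 5)) := [&& (2 * n + 3 <= p.1 + p.2)%N,
  (p.1 + p.2 <= 6 * n + 3)%N, (p.2 <= p.1 + 1 + 2 * n)%N & (p.1 + 1 <= p.2 + 2 * n)%N].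
rewrite [RHS](bigID inside) /= [X in _ + X]big1 ?addr0; last first.
  move=> p /andP[podd pout].
  have [j jE] : exists j : int, p.1%:Z + p.2%:Z + 1 = 2%:Z * (j + L%:Z).
    have : odd (p.1 + p.2) by rewrite oddD; case: (odd p.1) (odd p.2) podd => -[].
    by exists ((p.1 + p.2 + 1)./2%:Z - L%:Z); lia.
  rewrite mulrCA -!exprD addnA.
  rewrite (@half_exp_theta_exp i l m j (p.1%:Z - L%:Z + 1 - j)) //; [|lia|lia].
  have [out|out] : (n%:Z < j \/ j < - n%:Z) \/
      (n%:Z < p.1%:Z - L%:Z + 1 - j \/ p.1%:Z - L%:Z + 1 - j < - n%:Z).
  - by move: pout; rewrite /inside; lia.
  - have ij : (10 * n <= theta_exp i j)%N by apply: theta_exp_lb; lia.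
    by rewrite (expr_nilp xN) ?mulr0 //; lia.
  have lk : (10 * n <= theta_exp l (p.1%:Z - L%:Z + 1 - j))%N.
    by apply: theta_exp_lb; lia.
  by rewrite (expr_nilp xN) ?mulr0 //; lia.
(* [Ordinal S0] is only the default of [insubd]; [soE] and [joE] apply to all indices that occur. *)
have S0 : (0 < 4 * n + 5)%N by lia.
pose so (k : nat) : 'I_(4 * n + 5) := insubd (Ordinal S0) k.
pose jo (k : nat) : 'I_(2 * n).+1 := inord k.
pose g (q : 'I_(2 * n).+1 * 'I_(2 * n).+1) : 'I_(4 * n + 5) * 'I_(4 * n + 5) :=
  (so (q.1 + q.2 + 1)%N, so (q.1 + L - q.2)%N).
pose g' (p : 'I_(4 * n + 5) * 'I_(4 * n + 5)) : 'I_(2 * n).+1 * 'I_(2 * n).+1 :=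
  (jo ((p.1 + p.2 - (2 * n + 3))./2), jo ((p.1 + 1 + 2 * n - p.2)./2)).
have soE k : (k < 4 * n + 5)%N -> so k = k :> nat.
  by move=> kS; rewrite /so val_insubd kS.
have joE k : (k < (2 * n).+1)%N -> jo k = k :> nat by move=> kJ; rewrite /jo inordK.
have g1 q : (g q).1 = (q.1 + q.2 + 1)%N :> nat.
  by rewrite /= soE //; have := ltn_ord q.1; have := ltn_ord q.2; lia.
have g2 q : (g q).2 = (q.1 + L - q.2)%N :> nat.
  by rewrite /= soE //; have := ltn_ord q.1; have := ltn_ord q.2; lia.
rewrite [RHS](reindex_onto g g'); last first.
  move=> p /andP[podd /and4P[h1 h2 h3 h4]].
  have e1 : (g' p).1 = (p.1 + p.2 - (2 * n + 3))./2 :> nat by rewrite /= joE //; lia.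
  have e2 : (g' p).2 = (p.1 + 1 + 2 * n - p.2)./2 :> nat by rewrite /= joE //; lia.
  case: p podd h1 h2 h3 h4 e1 e2 => p1 p2 /= podd h1 h2 h3 h4 e1 e2.
  by congr (_, _); apply: val_inj; rewrite /= soE ?e1 ?e2; lia.
apply: eq_big => [q|q _].
  have hq1 := ltn_ord q.1; have hq2 := ltn_ord q.2.
  symmetry; apply/andP; split.
    by rewrite /inside g1 g2; lia.
  apply/eqP; case: q hq1 hq2 => q1 q2 /= hq1 hq2.
  have := g1 (q1, q2); have := g2 (q1, q2) => /= E2 E1.
  by congr (_, _); apply: val_inj; rewrite /= joE ?E1 ?E2; lia.
have hq1 := ltn_ord q.1; have hq2 := ltn_ord q.2.
rewrite g1 g2 [RHS]mulrCA [x ^+ m * _]mulrA -[x ^+ m * _]exprD -[x ^+ (m + _) * _]exprD.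
rewrite (@half_exp_theta_exp i l m (q.1%:Z - n%:Z) (q.2%:Z - n%:Z)) //; [|lia..].
rewrite [x ^+ (_ + _ + _)]exprD [x ^+ (9 + _)]exprD.
have -> : (-1) ^+ (q.1 + q.2 + 1).+1 = (-1) ^+ q.1 * (-1) ^+ q.2 :> A.
  by rewrite addn1 !exprS exprD !mulN1r opprK.
rewrite [(-1) ^+ (n + q.1)]exprD [(-1) ^+ (n + q.2)]exprD.
have sgn : (-1) ^+ n * (-1) ^+ n = 1 :> A by rewrite -expr2 sqrr_sign.
move: sgn; move: (_ ^+ n) (_ ^+ q.1) (_ ^+ q.2) (x ^+ 9) (x ^+ theta_exp i _)
  (x ^+ theta_exp l _) => c a b y u v sgn.
transitivity (c * c * (a * b * (y * u * v))); first by ring.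
by rewrite sgn; ring.
Qed.

(** * The Pluecker relation and the theta identity modulo [X^(10n)] *)

(** Three-term relation among the minors of a 2x4 matrix whose columns are the odd and even parts
    for [a], [b], [c], [d]. *)
Lemma parity_det_plucker (A : comNzRingType) (x : A) n a b c d :
  parity_det x n a b * parity_det x n c d - parity_det x n c a * parity_det x n d b
  - parity_det x n a d * parity_det x n c b = 0.
Proof. by rewrite /parity_det; ring. Qed.

Lemma theta_prod_sym (A : comNzRingType) (x : A) i n :
  (i <= 10)%N -> theta_prod x (10 - i) n = theta_prod x i n.
Proof.
move=> i10; rewrite /theta_prod subKn //.
by apply: eq_bigr => k _; rewrite mulrC.
Qed.

(** Difference of the two sides of [T_4^2 T_3^2 - x^2 T_1^2 T_2^2 = T_5^2 T_2 T_4], for products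
    truncated at [n]. *)
Definition theta_defect (A : comNzRingType) (x : A) (n : nat) : A :=
  theta_prod x 4 n ^+ 2 * theta_prod x 3 n ^+ 2
  - x ^+ 2 * (theta_prod x 1 n ^+ 2 * theta_prod x 2 n ^+ 2)
  - theta_prod x 5 n ^+ 2 * (theta_prod x 2 n * theta_prod x 4 n).

Lemma rmorph_theta_defect (A B : comNzRingType) (phi : {rmorphism A -> B}) x n :
  phi (theta_defect x n) = theta_defect (phi x) n.
Proof.
by rewrite /theta_defect !rmorphB !rmorphM !rmorph_theta_prod.
Qed.

Lemma theta_defect_nilp (F : fieldType) (A : comNzRingType)
    (phi : {rmorphism {poly F} -> A}) n :
  phi 'X ^+ (10 * n) = 0 -> phi 'X ^+ 18 * theta_defect (phi 'X) n = 0.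
Proof.
move=> xN.
have JT i : (0 < i < 10)%N ->
    qfact (phi 'X ^+ 10) n * theta_prod (phi 'X) i n = theta_sum (phi 'X) i n.
  exact: jacobi_triple_product_trunc.
have x10N : (phi 'X ^+ 10) ^+ n = 0 by rewrite -exprM.
set x := phi 'X in xN JT x10N *; set f := qfact (x ^+ 10) n in JT.
(* Each determinant accounts for two theta products, each with its own [f], and for [x^9]; a product
   of two determinants thus carries [f^4] and [x^18]. *)
suff : f * (f * (f * (f * (x ^+ 18 * theta_defect x n)))) = 0.
  by do 4 move/(qfact_cancel x10N).
have M i l m h k : (0 < l < i)%N -> (i < 10)%N -> (i + l <= 9)%N -> odd (i + l) ->
    (2 * m = i + l + 5)%N -> h = (i + l)%N -> k = (i - l)%N ->
    x ^+ 9 * (f * theta_prod x i n * (f * theta_prod x l n)) =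
    x ^+ m * parity_det x n h k.
  move=> li i10 il9 ilodd mE -> ->.
  by rewrite !JT; [apply: theta_sum_mul|lia..].
(* With columns [7, 1, 9, 3] the Pluecker terms are [(T_4 T_3)(T_6 T_3)], [(T_8 T_1)(T_2 T_1)] and
   [(T_5 T_2)(T_5 T_4)], where [T_6 = T_4] and [T_8 = T_2]. The powers [6+7], [2+7+4] and [6+7] of
   [x] all equal [13]. *)
have h71 := M 4 3 6 7 1 erefl erefl erefl erefl erefl erefl erefl.
have h93 := M 6 3 7 9 3 erefl erefl erefl erefl erefl erefl erefl.
have h97 := M 8 1 7 9 7 erefl erefl erefl erefl erefl erefl erefl.
have h31 := M 2 1 4 3 1 erefl erefl erefl erefl erefl erefl erefl.
have h73 := M 5 2 6 7 3 erefl erefl erefl erefl erefl erefl erefl.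
have h91 := M 5 4 7 9 1 erefl erefl erefl erefl erefl erefl erefl.
rewrite [theta_prod x 6 n](theta_prod_sym x n (erefl : (4 <= 10)%N)) in h93.
rewrite [theta_prod x 8 n](theta_prod_sym x n (erefl : (2 <= 10)%N)) in h97.
have P := parity_det_plucker x n 7 1 9 3.
rewrite /theta_defect.
transitivity ((x ^+ 6 * parity_det x n 7 1) * (x ^+ 7 * parity_det x n 9 3)
  - x ^+ 2 * ((x ^+ 7 * parity_det x n 9 7) * (x ^+ 4 * parity_det x n 3 1))
  - (x ^+ 6 * parity_det x n 7 3) * (x ^+ 7 * parity_det x n 9 1)).
  by rewrite -h71 -h93 -h97 -h31 -h73 -h91; ring.
transitivity (x ^+ 13 * 0 : A); last by rewrite mulr0.
by rewrite -P; ring.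
Qed.

(** The nilpotent identity is read in [F[X]/(X^(10n))], where vanishing means divisibility by
    [X^(10n)]; then [X^18] is cancelled. *)
Lemma theta_defect_dvd (F : fieldType) n : (1 < n)%N ->
  'X^(10 * n - 18) %| theta_defect ('X : {poly F}) n.
Proof.
move=> n1; set h : {poly F} := 'X^(10 * n).
have hE : mk_monic h = h by rewrite mk_monic_Xn; congr ('X^_); lia.
pose phi : {rmorphism {poly F} -> {poly %/ h}} := in_qpoly h.
have phi0 p : (phi p == 0) = (h %| p).
  apply/eqP/idP => [/(congr1 val) /= |].
    by rewrite hE /dvdp Pdiv.IdomainMonic.modpE ?monicXn // => ->.
  rewrite /dvdp Pdiv.IdomainMonic.modpE ?monicXn // => /eqP E.
  by apply: val_inj => /=; rewrite hE.
have xN : phi 'X ^+ (10 * n) = 0 by apply/eqP; rewrite -rmorphXn phi0 dvdpp.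
have /eqP := theta_defect_nilp xN.
rewrite -rmorph_theta_defect -rmorphXn -rmorphM phi0 /h.
have {1}-> : (10 * n = 18 + (10 * n - 18))%N by lia.
by rewrite exprD dvdp_mul2l // -size_poly_eq0 size_polyXn.
Qed.

(** * The real-valued modulus on the complex numbers *)

(** The norm of [R[i]] has values in [R[i]]; its real part allows estimates in the ordered field
    [R]. *)
Definition modulus (R : realType) (z : Cplx R) : R := complex.Re (`|z| : R[i]).

Lemma modulusE (R : realType) (z : Cplx R) : `|z| = ((modulus z)%:C : R[i]).
Proof. by rewrite /modulus normc_def. Qed.

Lemma modulus_ge0 (R : realType) (z : Cplx R) : 0 <= modulus z.
Proof. by rewrite -ler0c -modulusE normr_ge0. Qed.

Lemma modulusM (R : realType) (z w : Cplx R) :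
  modulus (z * w) = modulus z * modulus w.
Proof. by apply: complexI; rewrite rmorphM /= -!modulusE normrM. Qed.

Lemma modulusX (R : realType) (z : Cplx R) n : modulus (z ^+ n) = modulus z ^+ n.
Proof. by apply: complexI; rewrite rmorphXn /= -!modulusE normrX. Qed.

Lemma modulusV (R : realType) (z : Cplx R) : modulus z^-1 = (modulus z)^-1.
Proof. by apply: complexI; rewrite fmorphV /= -!modulusE normfV. Qed.

Lemma modulusN (R : realType) (z : Cplx R) : modulus (- z) = modulus z.
Proof. by rewrite /modulus normrN. Qed.

Lemma modulus1 (R : realType) : modulus (1 : Cplx R) = 1.
Proof. by rewrite /modulus normr1. Qed.

Lemma modulus0 (R : realType) : modulus (0 : Cplx R) = 0.
Proof. by rewrite /modulus normr0. Qed.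

Lemma modulus_lt (R : realType) (z : Cplx R) (r : R) :
  (`|z| < (r%:C : Cplx R)) = (modulus z < r).
Proof. by rewrite modulusE ltcR. Qed.

Lemma modulus_lt1 (R : realType) (z : Cplx R) : (`|z| < 1) = (modulus z < 1).
Proof. exact: (modulus_lt z 1). Qed.

Lemma modulusD (R : realType) (z w : Cplx R) :
  modulus (z + w) <= modulus z + modulus w.
Proof. by rewrite -lecR rmorphD /= -!modulusE ler_normD. Qed.

Lemma modulus_eq0 (R : realType) (z : Cplx R) : (modulus z == 0) = (z == 0).
Proof. by rewrite -(inj_eq (@complexI R)) -modulusE normr_eq0. Qed.

Lemma modulus_sum (R : realType) (I : Type) (s : seq I) (F : I -> Cplx R) :
  modulus (\sum_(i <- s) F i) <= \sum_(i <- s) modulus (F i).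
Proof.
elim/big_ind2: _ => [|x a y b xa yb|i _] //; first by rewrite modulus0.
by rewrite (le_trans (modulusD _ _)) // lerD.
Qed.

Lemma modulus_ReIm (R : realType) (z : Cplx R) :
  [/\ `|complex.Re (z : R[i])| <= modulus z, `|complex.Im (z : R[i])| <= modulus z
    & modulus z <= `|complex.Re (z : R[i])| + `|complex.Im (z : R[i])|].
Proof.
rewrite /modulus normc_def /=; set a := complex.Re _; set b := complex.Im _; split.
- by rewrite -sqrtr_sqr ler_wsqrtr // lerDl sqr_ge0.
- by rewrite -sqrtr_sqr ler_wsqrtr // lerDr sqr_ge0.
rewrite -[leRHS]ger0_norm ?addr_ge0 // -sqrtr_sqr ler_wsqrtr //.
have := normr_ge0 a; have := normr_ge0 b.
rewrite -(real_normK (num_real a)) -(real_normK (num_real b)); nra.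
Qed.

Lemma cvg_modulusP (R : realType) (w : nat -> Cplx R) (l : Cplx R) :
  (w @ \oo --> l) <-> (fun n => modulus (w n - l)) @ \oo --> (0 : R).
Proof.
split=> [/cvgrPdist_lt h|/cvgr0Pnorm_lt h].
  apply/cvgr0Pnorm_lt => e e0.
  have e0' : (0 : Cplx R) < e%:C by rewrite ltcR.
  near=> n.
  rewrite ger0_norm ?modulus_ge0 // -modulus_lt distrC.
  by near: n; exact: h.
apply/cvgrPdist_lt => e e0.
(* In the partial order of [R[i]], [0 < e] forces the imaginary part of [e] to vanish. *)
have eE : e = (complex.Re (e : R[i]))%:C :> R[i].
  by move: e0; case: e => a b; rewrite ltcE /= => /andP[/eqP -> _].
have e0' : 0 < complex.Re (e : R[i]) by move: e0; rewrite {1}eE ltcR.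
near=> n.
rewrite distrC eE modulus_lt -[ltLHS]ger0_norm ?modulus_ge0 //.
by near: n; exact: h.
Unshelve. all: by end_near. Qed.

(** * Convergence and nonvanishing of infinite products *)

Lemma geometric_sum_le (R : realType) (r : R) n :
  0 <= r < 1 -> \sum_(0 <= k < n) r ^+ k <= (1 - r)^-1.
Proof.
move=> /andP[r0 r1]; have r1' : 0 < 1 - r by rewrite subr_gt0.
have -> : \sum_(0 <= k < n) r ^+ k = (1 - r ^+ n) / (1 - r).
  apply: (mulIf (lt0r_neq0 r1')); rewrite divfK ?lt0r_neq0 //.
  elim: n => [|n IHn]; first by rewrite big_nil mul0r expr0 subrr.
  by rewrite big_nat_recr //= mulrDl IHn exprS; ring.
by rewrite ler_piMl ?invr_ge0 ?(ltW r1') // gerBl exprn_ge0.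
Qed.

Lemma prod1D_le_expR (R : realType) (u : nat -> R) n : (forall k, 0 <= u k) ->
  \prod_(0 <= k < n) (1 + u k) <= expR (\sum_(0 <= k < n) u k).
Proof.
move=> u0; elim: n => [|n IHn]; first by rewrite !big_nil expR0.
rewrite !big_nat_recr //= expRD ler_pM ?expR_ge1Dx ?addr_ge0 //.
by apply: prodr_ge0 => k _; rewrite addr_ge0.
Qed.

Lemma cvg_geometric_increments (R : realType) (u : nat -> R) (C r : R) :
  0 <= r < 1 -> (forall n, `|u n.+1 - u n| <= C * r ^+ n) -> cvgn u.
Proof.
move=> /andP[r0 r1] uC.
have h : cvgn [normed series (telescope u)].
  apply: (@series_le_cvg _ _ (fun n => C * r ^+ n)) => //.
  - by move=> n; exact: normr_ge0.
  - by move=> n; apply: le_trans (uC n); exact: normr_ge0.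
  - by apply: is_cvg_geometric_series; rewrite ger0_norm.
have {}h := normed_cvg h.
have -> : u = (fun n => u 0%N + series (telescope u) n).
  by apply/funext => n; exact: eq_sum_telescope.
by apply: is_cvgD => //; exact: is_cvg_cst.
Qed.

Lemma cvg_geometric_incrementsC (R : realType) (w : nat -> Cplx R) (C r : R) :
  0 <= r < 1 -> (forall n, modulus (w n.+1 - w n) <= C * r ^+ n) -> cvgn w.
Proof.
move=> r01 wC.
pose x n := complex.Re (w n : R[i]); pose y n := complex.Im (w n : R[i]).
have [hx hy] : cvgn x /\ cvgn y.
  split; apply: (cvg_geometric_increments r01) => n; apply: le_trans (wC n);
    have [a b _] := modulus_ReIm (w n.+1 - w n).
  - by apply: le_trans a; rewrite /x raddfB.
  - by apply: le_trans b; rewrite /y raddfB.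
apply/cvg_ex; exists ((limn x +i* limn y)%C : Cplx R); apply/cvg_modulusP.
apply: (@squeeze_cvgr _ _ _ _ (cst 0) (fun n => `|x n - limn x| + `|y n - limn y|)).
- near=> n; rewrite modulus_ge0 /=.
  have [_ _ c] := modulus_ReIm (w n - (limn x +i* limn y)%C).
  by apply: le_trans c _; rewrite !raddfB.
- exact: cvg_cst.
rewrite -[0]addr0; apply: cvgD; apply/norm_cvg0P.
  by rewrite -(subrr (limn x)); apply: cvgB => //; exact: cvg_cst.
by rewrite -(subrr (limn y)); apply: cvgB => //; exact: cvg_cst.
Unshelve. all: by end_near. Qed.

Lemma modulus_prod (R : realType) (I : Type) (s : seq I) (F : I -> Cplx R) :
  modulus (\prod_(i <- s) F i) = \prod_(i <- s) modulus (F i).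
Proof. exact: (big_morph _ (@modulusM R) (modulus1 R)). Qed.

Lemma prod1D_geometric_le (R : realType) (u : nat -> R) (C r : R) n :
  0 <= C -> 0 <= r < 1 -> (forall k, 0 <= u k <= C * r ^+ k) ->
  \prod_(0 <= k < n) (1 + u k) <= expR (C / (1 - r)).
Proof.
move=> C0 r01 uC; apply: le_trans (prod1D_le_expR _ _) _.
  by move=> k; have /andP[] := uC k.
rewrite ler_expR; apply: (@le_trans _ _ (\sum_(0 <= k < n) C * r ^+ k)).
  by apply: ler_sum => k _; have /andP[] := uC k.
by rewrite -mulr_sumr ler_wpM2l // geometric_sum_le.
Qed.

(** The partial products are bounded by [exp(C / (1 - r))], so their increments decay
    geometrically. *)
Lemma cvg_infinite_prod (R : realType) (z : nat -> Cplx R) (C r : R) :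
  0 <= r < 1 -> (forall k, modulus (z k) <= C * r ^+ k) ->
  cvgn (fun n => \prod_(0 <= k < n) (1 + z k)).
Proof.
move=> r01 zC.
have C0 : 0 <= C by have := zC 0%N; rewrite expr0 mulr1; apply: le_trans; apply: modulus_ge0.
apply: (@cvg_geometric_incrementsC _ _ (expR (C / (1 - r)) * C) r r01) => n.
rewrite big_nat_recr //= mulrDr mulr1 addrAC subrr add0r modulusM -mulrA.
rewrite ler_pM ?modulus_ge0 // modulus_prod.
apply: (@le_trans _ _ (\prod_(0 <= k < n) (1 + modulus (z k)))); last first.
  by apply: prod1D_geometric_le => // k; rewrite zC andbT modulus_ge0.
apply: ler_prod => k _; rewrite modulus_ge0 /=.
by rewrite (le_trans (modulusD _ _)) // modulus1.
Qed.

(** The inverse factors [1 + z'_k], [z'_k = -z_k / (1 + z_k)], satisfy a bound of the same kind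
    because [|1 + z_k| >= 1 - C > 0]. Both products converge, and their limits multiply to [1]. *)
Lemma infinite_prod_neq0 (R : realType) (z : nat -> Cplx R) (C r : R) :
  0 <= r < 1 -> C < 1 -> (forall k, modulus (z k) <= C * r ^+ k) ->
  limn (fun n => \prod_(0 <= k < n) (1 + z k)) != 0.
Proof.
move=> r01 C1 zC.
have C0 : 0 <= C by have := zC 0%N; rewrite expr0 mulr1; apply: le_trans; apply: modulus_ge0.
have lb k : 1 - C <= modulus (1 + z k).
  have : modulus (z k) <= C.
    apply: le_trans (zC k) _; rewrite ler_piMr // exprn_ile1 //; by case/andP: r01 => ? /ltW.
  have := modulusD (1 + z k) (- z k); rewrite addrK modulus1 modulusN; lra.
have C1' : 0 < 1 - C by rewrite subr_gt0.
have nz k : 1 + z k != 0.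
  by rewrite -modulus_eq0 gt_eqF //; apply: lt_le_trans (lb k).
pose z' k := - z k / (1 + z k).
have z'E k : (1 + z k) * (1 + z' k) = 1.
  by rewrite /z'; field; exact: nz.
have z'C k : modulus (z' k) <= C / (1 - C) * r ^+ k.
  rewrite /z' modulusM modulusN modulusV mulrAC ler_pM ?invr_ge0 ?modulus_ge0 //.
  by rewrite lef_pV2 // posrE //; apply: lt_le_trans (lb k).
have h1 := cvg_infinite_prod r01 zC; have h2 := cvg_infinite_prod r01 z'C.
have PQ n : (\prod_(0 <= k < n) (1 + z k)) * (\prod_(0 <= k < n) (1 + z' k)) = 1.
  by rewrite -big_split /= big1.
move: h1 h2 PQ; set P := fun n => _; set Q := fun n => \prod_(0 <= k < n) (1 + z' k).
move=> h1 h2 PQ; apply/eqP => l0.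
have := cvgM h1 h2; rewrite l0 mul0r.
have {}PQ : P \* Q = cst 1 by apply/funext => n; exact: PQ.
rewrite PQ => /(_ _)/(cvg_lim (@norm_hausdorff _ _)).
by rewrite lim_cst // => /eqP; rewrite oner_eq0.
Qed.

(** * Coefficientwise majorants and vanishing of the defect in the limit *)

Definition majorized (R : realType) (p : {poly Cplx R}) (P : {poly R}) : Prop :=
  forall i, modulus p`_i <= P`_i.

Lemma majorizedD (R : realType) (p q : {poly Cplx R}) (P Q : {poly R}) :
  majorized p P -> majorized q Q -> majorized (p + q) (P + Q).
Proof.
by move=> pP qQ i; rewrite !coefD (le_trans (modulusD _ _)) // lerD.
Qed.

Lemma majorizedB (R : realType) (p q : {poly Cplx R}) (P Q : {poly R}) :
  majorized p P -> majorized q Q -> majorized (p - q) (P + Q).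
Proof.
move=> pP qQ; apply: majorizedD => // i.
by rewrite coefN modulusN.
Qed.

Lemma majorizedM (R : realType) (p q : {poly Cplx R}) (P Q : {poly R}) :
  majorized p P -> majorized q Q -> majorized (p * q) (P * Q).
Proof.
move=> pP qQ i; rewrite !coefM (le_trans (modulus_sum _ _)) //.
apply: ler_sum => j _; rewrite modulusM.
by apply: ler_pM; rewrite ?modulus_ge0.
Qed.

Lemma majorizedXn (R : realType) n : majorized ('X^n : {poly Cplx R}) ('X^n).
Proof.
by move=> i; rewrite !coefXn; case: (i == n); rewrite ?modulus1 ?modulus0.
Qed.

Lemma majorized_sqr (R : realType) (p : {poly Cplx R}) (P : {poly R}) :
  majorized p P -> majorized (p ^+ 2) (P ^+ 2).
Proof. by move=> pP; rewrite !expr2; apply: majorizedM. Qed.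

Definition theta_major (R : realType) (i n : nat) : {poly R} :=
  \prod_(k < n) ((1 + 'X^(i + 10 * k)) * (1 + 'X^(10 - i + 10 * k))).

Lemma majorized_theta_prod (R : realType) i n :
  majorized (theta_prod ('X : {poly Cplx R}) i n) (theta_major R i n).
Proof.
have maj1 : majorized (1 : {poly Cplx R}) 1.
  by have := @majorizedXn R 0; rewrite !expr0.
apply: big_ind2 => //; first by move=> *; apply: majorizedM.
by move=> k _; apply: majorizedM; apply: majorizedB => //; apply: majorizedXn.
Qed.

Lemma theta_major_bound (R : realType) (r : R) i n : 0 <= r < 1 ->
  0 <= (theta_major R i n).[r] <= expR (1 / (1 - r)) ^+ 2.
Proof.
move=> r01; have [r0 r1] := andP r01.
rewrite /theta_major horner_prod.
under eq_bigr => k _ do rewrite hornerM !hornerD hornerC !hornerXn.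
have B j : 0 <= \prod_(k < n) (1 + r ^+ (j + 10 * k)) <= expR (1 / (1 - r)).
  rewrite prodr_ge0 /=; last by move=> k _; rewrite addr_ge0 // exprn_ge0.
  rewrite -(big_mkord xpredT (fun k => 1 + r ^+ (j + 10 * k))).
  apply: prod1D_geometric_le => // k; rewrite exprn_ge0 // mul1r.
  by rewrite ler_wiXn2l // ?ltW //; lia.
rewrite big_split /=; have /andP[a0 a1] := B i; have /andP[b0 b1] := B (10 - i)%N.
by rewrite mulr_ge0 //= expr2 ler_pM.
Qed.

(** Only degrees [i >= N] contribute, and there [|q|^i <= (|q|/r)^N r^i]. *)
Lemma majorized_horner_Xn (R : realType) (p : {poly Cplx R}) (P : {poly R})
    (q : Cplx R) (r : R) N :
  majorized p P -> 'X^N %| p -> modulus q <= r -> 0 < r ->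
  modulus p.[q] <= (modulus q / r) ^+ N * P.[r].
Proof.
move=> pP Np qr r0; set m := maxn (size p) (size P).
rewrite (@horner_coef_wide _ m p) ?leq_maxl // (@horner_coef_wide _ m P) ?leq_maxr //.
rewrite (le_trans (modulus_sum _ _)) // mulr_sumr; apply: ler_sum => i _.
rewrite modulusM modulusX.
have P0 : 0 <= P`_i by apply: le_trans (pP i); apply: modulus_ge0.
have qr0 : 0 <= modulus q / r by rewrite divr_ge0 ?modulus_ge0 // ltW.
have [iN|Ni] := ltnP i N.
  case/dvdpP: Np => p' ->; rewrite coefMXn iN modulus0 mul0r.
  by rewrite mulr_ge0 ?exprn_ge0 // mulr_ge0 // exprn_ge0 // ltW.
have -> : modulus q ^+ i = (modulus q / r) ^+ i * r ^+ i.
  by rewrite -exprMn divfK // gt_eqF.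
rewrite mulrCA; apply: ler_pM.
- by rewrite exprn_ge0.
- by rewrite mulr_ge0 ?modulus_ge0 ?exprn_ge0 // ltW.
- by rewrite ler_wiXn2l // ler_pdivrMr // mul1r.
- by rewrite ler_wpM2r // exprn_ge0 // ltW.
Qed.

(** With [r] midway between [|q|] and [1], the majorant at [r] stays bounded in [n], while
    divisibility by [X^(10n-18)] gives a factor tending to [0]. *)
Lemma theta_defect_cvg0 (R : realType) (q : Cplx R) : modulus q < 1 ->
  (fun n => theta_defect q n) @ \oo --> (0 : Cplx R).
Proof.
move=> q1; apply/cvg_modulusP.
pose r := (modulus q + 1) / 2.
have q0 := modulus_ge0 q.
have r0 : 0 < r by rewrite /r; lra.
have r1 : r < 1 by rewrite /r; lra.
have qr : modulus q < r by rewrite /r; lra.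
pose B := expR (1 / (1 - r)) ^+ 2.
have TB i n : 0 <= (theta_major R i n).[r] <= B.
  by apply: theta_major_bound; rewrite r1 ltW.
have B0 : 0 <= B by rewrite exprn_ge0 // expR_ge0.
pose t := modulus q / r.
have t0 : 0 <= t by rewrite divr_ge0 // ltW.
have t1 : t < 1 by rewrite ltr_pdivrMr // mul1r.
have bound n : (1 < n)%N -> modulus (theta_defect q n) <= t ^+ n * (3 * B ^+ 4).
  move=> n1.
  have -> : theta_defect q n = (theta_defect ('X : {poly Cplx R}) n).[q].
    transitivity (theta_defect (('X : {poly Cplx R}).[q]) n); first by rewrite hornerX.
    exact/esym/(rmorph_theta_defect (horner_eval q)).
  pose T i := theta_major R i n.
  pose P := T 4%N ^+ 2 * T 3%N ^+ 2 + 'X^2 * (T 1%N ^+ 2 * T 2%N ^+ 2)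
    + T 5%N ^+ 2 * (T 2%N * T 4%N).
  have mP : majorized (theta_defect ('X : {poly Cplx R}) n) P.
    have mT i : majorized (theta_prod ('X : {poly Cplx R}) i n) (T i).
      exact: majorized_theta_prod.
    apply: majorizedB; last by apply: majorizedM; [apply: majorized_sqr|apply: majorizedM].
    apply: majorizedB; first by apply: majorizedM; apply: majorized_sqr.
    apply: majorizedM; first exact: majorizedXn.
    by apply: majorizedM; apply: majorized_sqr.
  apply: le_trans (majorized_horner_Xn mP (theta_defect_dvd _ n1) (ltW qr) r0) _.
  rewrite -/t; apply: ler_pM; rewrite ?exprn_ge0 //.
  - rewrite /P !(hornerD, hornerM) hornerX.
    have h i : 0 <= (T i).[r] by have /andP[] := TB i n.
    by do ?[apply: addr_ge0|apply: mulr_ge0]; rewrite ?h ?(ltW r0).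
  (* Here [n >= 2] gives [n <= 10n - 18]. *)
  - by rewrite ler_wiXn2l // ?(ltW t1) //; lia.
  rewrite /P !(hornerD, hornerM) hornerX.
  have M4 (a b c d : R) : 0 <= a <= B -> 0 <= b <= B -> 0 <= c <= B -> 0 <= d <= B ->
      0 <= a * b * (c * d) <= B ^+ 4.
    move=> /andP[a0 a1] /andP[b0 b1] /andP[c0 c1] /andP[d0 d1].
    have -> : B ^+ 4 = B * B * (B * B) by ring.
    by rewrite !mulr_ge0 //= !ler_pM ?mulr_ge0.
  have TB' i : 0 <= (T i).[r] <= B by exact: TB.
  have /andP[_ h1] := M4 _ _ _ _ (TB' 4%N) (TB' 4%N) (TB' 3%N) (TB' 3%N).
  have /andP[h20 h2] := M4 _ _ _ _ (TB' 1%N) (TB' 1%N) (TB' 2%N) (TB' 2%N).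
  have /andP[_ h3] := M4 _ _ _ _ (TB' 5%N) (TB' 5%N) (TB' 2%N) (TB' 4%N).
  move: h1 h20 h2 h3; clearbody T.
  set a := (T 4%N).[r]; set b := (T 3%N).[r]; set c := (T 1%N).[r].
  set d := (T 2%N).[r]; set e := (T 5%N).[r] => h1 h20 h2 h3.
  have h4 : r * r * (c * c * (d * d)) <= B ^+ 4.
    by apply: le_trans h2; rewrite ler_piMl // mulr_ile1 // ltW.
  by move: h1 h3 h4; lra.
apply: (@squeeze_cvgr _ _ _ _ (cst 0) (fun n => t ^+ n * (3 * B ^+ 4))).
- near=> n; rewrite modulus_ge0 /= subr0; apply: bound.
  by near: n; exists 2%N.
- exact: cvg_cst.
rewrite -[0](mul0r (3 * B ^+ 4)); apply: cvgM; last exact: cvg_cst.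
by apply: cvg_expr; rewrite ger0_norm.
Unshelve. all: by end_near. Qed.

(** * q-Pochhammer symbols and the identity between infinite products *)

Lemma cvgn_lim_unique (R : realType) (w : nat -> Cplx R) (l l' : Cplx R) :
  w @ \oo --> l -> w @ \oo --> l' -> l = l'.
Proof. by move=> h h'; apply: (@cvg_unique _ (@norm_hausdorff _ _) _ _ _ _ h h'). Qed.

Lemma cvgnC_mul (R : realType) (u v : nat -> Cplx R) (a b : Cplx R) :
  u @ \oo --> a -> v @ \oo --> b -> (fun n => u n * v n) @ \oo --> a * b.
Proof. by move=> hu hv; exact: (@cvgM (Cplx R) nat \oo _ u v a b hu hv). Qed.

Lemma cvgnC_add (R : realType) (u v : nat -> Cplx R) (a b : Cplx R) :
  u @ \oo --> a -> v @ \oo --> b -> (fun n => u n + v n) @ \oo --> a + b.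
Proof. by move=> hu hv; exact: (@cvgD (Cplx R) (Cplx R) nat \oo _ u v a b hu hv). Qed.

Lemma cvgnC_sub (R : realType) (u v : nat -> Cplx R) (a b : Cplx R) :
  u @ \oo --> a -> v @ \oo --> b -> (fun n => u n - v n) @ \oo --> a - b.
Proof. by move=> hu hv; exact: (@cvgB (Cplx R) (Cplx R) nat \oo _ u v a b hu hv). Qed.

Lemma cvgnC_cst (R : realType) (a : Cplx R) : (fun _ : nat => a) @ \oo --> a.
Proof. exact: cvg_cst. Qed.

Lemma qpoch_factor_bound (R : realType) (z q : Cplx R) k :
  modulus (- (z * q ^+ k)) <= modulus z * modulus q ^+ k.
Proof. by rewrite modulusN modulusM modulusX. Qed.

Lemma modulus_range (R : realType) (q : Cplx R) :
  modulus q < 1 -> 0 <= modulus q < 1.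
Proof. by rewrite modulus_ge0. Qed.

Lemma modulusX_lt1 (R : realType) (q : Cplx R) n :
  modulus q < 1 -> (0 < n)%N -> modulus (q ^+ n) < 1.
Proof.
by move=> q1 n0; rewrite modulusX exprn_ilt1 ?modulus_ge0 // -lt0n.
Qed.

Lemma qpoch_cvg (R : realType) (z q : Cplx R) : modulus q < 1 ->
  (fun n : nat => \prod_(0 <= k < n) (1 - z * q ^+ k)) @ \oo --> qpoch z q.
Proof.
move=> q1.
exact: (cvg_infinite_prod (modulus_range q1) (qpoch_factor_bound z q)).
Qed.

Lemma qpoch_neq0 (R : realType) (z q : Cplx R) :
  modulus q < 1 -> modulus z < 1 -> qpoch z q != 0.
Proof.
move=> q1 z1.
exact: (infinite_prod_neq0 (modulus_range q1) z1 (qpoch_factor_bound z q)).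
Qed.

Lemma qpoch_mulN (R : realType) (z q : Cplx R) : modulus q < 1 ->
  qpoch z q * qpoch (- z) q = qpoch (z ^+ 2) (q ^+ 2).
Proof.
move=> q1; have q21 := modulusX_lt1 q1 (isT : (0 < 2)%N).
apply: (cvgn_lim_unique _ (qpoch_cvg (z := z ^+ 2) q21)).
have := cvgM (qpoch_cvg (z := z) q1) (qpoch_cvg (z := - z) q1).
move=> /(_ _) h; apply: cvg_trans h; apply: near_eq_cvg; near=> n => /=.
rewrite -big_split /=; apply: eq_bigr => k _.
by rewrite -exprM mulnC exprM; ring.
Unshelve. all: by end_near. Qed.

Lemma cvgn_muln m : (0 < m)%N -> (fun n : nat => (m * n)%N) @ \oo --> \oo.
Proof.
move=> m0; apply/cvgnyPge => A; near=> n.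
have : (A <= n)%N by near: n; exact: nbhs_infty_ge.
by move/leq_trans; apply; exact: leq_pmull.
Unshelve. all: by end_near. Qed.

(** The factors of even and of odd index are separated in the partial products of length [2n]. *)
Lemma qpoch_bisect (R : realType) (z q : Cplx R) : modulus q < 1 ->
  qpoch z q = qpoch z (q ^+ 2) * qpoch (z * q) (q ^+ 2).
Proof.
move=> q1; have q21 := modulusX_lt1 q1 (isT : (0 < 2)%N).
have := cvgM (qpoch_cvg (z := z) q21) (qpoch_cvg (z := z * q) q21).
move=> /(_ _) h; apply: cvgn_lim_unique h.
have := cvg_comp _ _ (cvgn_muln (isT : (0 < 2)%N)) (qpoch_cvg (z := z) q1).
move=> h; apply: cvg_trans h; apply: near_eq_cvg; near=> n => /=.
elim: (n) => [|m IHm]; first by rewrite muln0 !big_nil mulr1.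
rewrite mulnS !addSn add0n !big_nat_recr //= [RHS]mulrACA -IHm.
by rewrite exprS exprM; ring.
Unshelve. all: by end_near. Qed.

Lemma theta_prod_cvg (R : realType) (q : Cplx R) i : modulus q < 1 ->
  (fun n => theta_prod q i n) @ \oo -->
    qpoch (q ^+ i) (q ^+ 10) * qpoch (q ^+ (10 - i)) (q ^+ 10).
Proof.
move=> q1; have q10 := modulusX_lt1 q1 (isT : (0 < 10)%N).
have := cvgM (qpoch_cvg (z := q ^+ i) q10) (qpoch_cvg (z := q ^+ (10 - i)) q10).
move=> /(_ _) h; apply: cvg_trans h; apply: near_eq_cvg; near=> n => /=.
rewrite -big_split /= /theta_prod big_mkord; apply: eq_bigr => k _.
by rewrite -!exprM -!exprD.
Unshelve. all: by end_near. Qed.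

Lemma theta_weierstrass (R : realType) (q : Cplx R) : modulus q < 1 ->
  let T i := qpoch (q ^+ i) (q ^+ 10) * qpoch (q ^+ (10 - i)) (q ^+ 10) in
  T 4%N ^+ 2 * T 3%N ^+ 2 - q ^+ 2 * (T 1%N ^+ 2 * T 2%N ^+ 2) =
  T 5%N ^+ 2 * (T 2%N * T 4%N).
Proof.
move=> q1 T; apply/eqP; rewrite -subr_eq0; apply/eqP.
apply: (cvgn_lim_unique _ (theta_defect_cvg0 q1)).
have h i := theta_prod_cvg (i := i) q1.
have S (u : nat -> Cplx R) (a : Cplx R) : u @ \oo --> a ->
  (fun n => u n ^+ 2) @ \oo --> a ^+ 2 by move=> hu; exact: (cvgnC_mul hu hu).
exact: (cvgnC_sub (cvgnC_sub
    (cvgnC_mul (S _ _ (h 4%N)) (S _ _ (h 3%N)))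
    (cvgnC_mul (@cvgnC_cst R (q ^+ 2)) (cvgnC_mul (S _ _ (h 1%N)) (S _ _ (h 2%N)))))
  (cvgnC_mul (S _ _ (h 5%N)) (cvgnC_mul (h 2%N) (h 4%N)))).
Qed.

(** Here [p_i] stands for [(q^i; q^10)], [n_i] for [(-q^i; q^5)] and [s] for [q^2]. Solving for the
    [n_i] turns the left side into the theta identity divided by [T_2 T_4]; both sides then equal
    [p5^4]. *)
Lemma theta_quotient_elim (F : fieldType)
    (s p1 p2 p3 p4 p5 p6 p7 p8 p9 p10 n1 n2 n3 n4 : F) :
  p1 != 0 -> p2 != 0 -> p3 != 0 -> p4 != 0 -> p6 != 0 -> p7 != 0 -> p8 != 0 ->
  p9 != 0 -> p10 != 0 ->
  p1 * p6 * n1 = p2 -> p2 * p7 * n2 = p4 -> p3 * p8 * n3 = p6 -> p4 * p9 * n4 = p8 ->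
  (p4 * p6) ^+ 2 * (p3 * p7) ^+ 2 - s * ((p1 * p9) ^+ 2 * (p2 * p8) ^+ 2) =
    (p5 * p5) ^+ 2 * (p2 * p8 * (p4 * p6)) ->
  n2 * n3 * (p3 * p7) ^+ 3 - s * (n1 * n4 * (p1 * p9) ^+ 3) =
    (p5 * p10) ^+ 4 / p10 ^+ 4.
Proof.
move=> h1 h2 h3 h4 h6 h7 h8 h9 h10 N1 N2 N3 N4 W.
have solve (a b c : F) : a != 0 -> a * b = c -> b = c / a.
  by move=> a0 <-; rewrite mulrAC divff // mul1r.
have E1 := solve _ _ _ (mulf_neq0 h1 h6) N1.
have E2 := solve _ _ _ (mulf_neq0 h2 h7) N2.
have E3 := solve _ _ _ (mulf_neq0 h3 h8) N3.
have E4 := solve _ _ _ (mulf_neq0 h4 h9) N4.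
have d0 : p2 * p8 * (p4 * p6) != 0 by rewrite !mulf_neq0.
transitivity (((p4 * p6) ^+ 2 * (p3 * p7) ^+ 2
    - s * ((p1 * p9) ^+ 2 * (p2 * p8) ^+ 2)) / (p2 * p8 * (p4 * p6))).
  by rewrite E1 E2 E3 E4; field; rewrite h1 h2 h3 h4 h6 h7 h8 h9.
by rewrite W mulfK //; field.
Qed.

Lemma product_identity (R : realType) (q : Cplx R) : modulus q < 1 ->
  qpochs [:: - q ^+ 2; - q ^+ 3] (q ^+ 5) * qpochs [:: q ^+ 3; q ^+ 7] (q ^+ 10) ^+ 3
  - q ^+ 2 * (qpochs [:: - q; - q ^+ 4] (q ^+ 5)
              * qpochs [:: q; q ^+ 9] (q ^+ 10) ^+ 3) =
  eulerf 1 (q ^+ 5) ^+ 4 / eulerf 2 (q ^+ 5) ^+ 4.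
Proof.
move=> q1; have q5 := modulusX_lt1 q1 (isT : (0 < 5)%N).
have q10 := modulusX_lt1 q1 (isT : (0 < 10)%N).
pose P i := qpoch (q ^+ i) (q ^+ 10).
have P0 i : (0 < i)%N -> P i != 0.
  by move=> i0; apply: qpoch_neq0 => //; exact: modulusX_lt1.
have bisect i : qpoch (q ^+ i) (q ^+ 5) = P i * P (i + 5)%N.
  by rewrite qpoch_bisect // -exprM -exprD.
(* This is [(z; p)(-z; p) = (z^2; p^2)] at [z = q^i], [p = q^5], after bisecting [(q^i; q^5)]. *)
have mulN i : P i * P (i + 5)%N * qpoch (- q ^+ i) (q ^+ 5) = P (2 * i)%N.
  by rewrite -bisect qpoch_mulN // -!exprM mulnC.
have N1 := mulN 1%N; have N2 := mulN 2%N; have N3 := mulN 3%N; have N4 := mulN 4%N.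
rewrite expr1 in N1.
have W := theta_weierstrass q1.
rewrite /= -!/(P _) in W.
rewrite /qpochs !big_cons !big_nil !mulr1 /eulerf -!exprM.
rewrite (bisect 5%N).
rewrite -[qpoch (q ^+ 3) _]/(P 3%N) -[qpoch (q ^+ 7) _]/(P 7%N).
rewrite -[qpoch (q ^+ 9) _]/(P 9%N) -[qpoch q _]/(P 1%N) -[qpoch (q ^+ _) _]/(P 10%N).
exact: (theta_quotient_elim (P0 1%N isT) (P0 2%N isT) (P0 3%N isT) (P0 4%N isT)
  (P0 6%N isT) (P0 7%N isT) (P0 8%N isT) (P0 9%N isT) (P0 10%N isT) N1 N2 N3 N4 W).
Qed.

(** * Uniqueness of power series coefficients *)

Lemma power_series_terms_bounded (R : realType) (d : nat -> Cplx R) (x : Cplx R) :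
  (fun N : nat => \sum_(0 <= n < N) d n * x ^+ n) @ \oo --> (0 : Cplx R) ->
  exists M : R, forall n, modulus (d n * x ^+ n) <= M.
Proof.
move=> /cvg_modulusP h.
have /cvg_seq_bounded /bounded_fun_has_ubound[M hM] : cvgn (fun N : nat =>
    modulus (\sum_(0 <= n < N) d n * x ^+ n - 0)) by apply/cvg_ex; exists 0.
have {}hM N : modulus (\sum_(0 <= n < N) d n * x ^+ n) <= M.
  by rewrite -[X in modulus X]subr0; apply: hM; exists N.
exists (M + M) => n.
have -> : d n * x ^+ n = \sum_(0 <= k < n.+1) d k * x ^+ k
    + - \sum_(0 <= k < n) d k * x ^+ k by rewrite big_nat_recr //= addrAC subrr add0r.
by rewrite (le_trans (modulusD _ _)) // modulusN lerD.
Qed.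

(** Boundedness of the terms at [1/2] gives [|d_n| <= M 2^n], so at a small [t > 0] everything
    beyond [d_0] is small. Assuming convergence only for [x != 0] allows the use for a series
    divided by [x]. *)
Lemma power_series_head_eq0 (R : realType) (d : nat -> Cplx R) :
  (forall x : Cplx R, x != 0 -> modulus x < 1 ->
    (fun N : nat => \sum_(0 <= n < N) d n * x ^+ n) @ \oo --> (0 : Cplx R)) ->
  d 0%N = 0.
Proof.
move=> hd.
have modR (t : R) : 0 <= t -> modulus (t%:C : Cplx R) = t.
  move=> t0; have [_ _] := modulus_ReIm (t%:C : Cplx R).
  have [h _ _] := modulus_ReIm (t%:C : Cplx R); move: h => /=.
  by rewrite normr0 addr0 ger0_norm // => a b; apply/eqP; rewrite eq_le a b.
have RC0 (t : R) : 0 < t -> (t%:C : Cplx R) != 0.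
  by move=> t0; rewrite -modulus_eq0 modR ?gt_eqF // ltW.
have half1 : modulus ((2^-1 : R)%:C : Cplx R) = 2^-1 by apply: modR; lra.
have [M hM] : exists M : R, forall n, modulus (d n * ((2^-1)%:C : Cplx R) ^+ n) <= M.
  by apply/power_series_terms_bounded/hd; [apply: RC0; lra|rewrite half1; lra].
have M0 : 0 <= M by apply: le_trans (hM 0%N); exact: modulus_ge0.
have dM n : modulus (d n) <= M * 2 ^+ n.
  have := hM n; rewrite modulusM modulusX half1 exprVn ler_pdivrMr ?exprn_gt0 //.
apply/eqP; rewrite -modulus_eq0; apply/eqP/le_anti; rewrite modulus_ge0 andbT.
apply/ler_addgt0Pr => e e0; rewrite add0r.
(* This choice ensures both [4t <= 1], so that the ratio [2t] is at most [1/2], and [4Mt <= e/2]. *)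
pose t := e / (8 * M + 8 + 4 * e).
have D0 : 0 < 8 * M + 8 + 4 * e by lra.
have t0 : 0 < t by rewrite divr_gt0.
have tE : t * (8 * M + 8 + 4 * e) = e by rewrite divfK // gt_eqF.
have t4 : 4 * t <= 1 by rewrite /t mulrA ler_pdivrMr //; lra.
have tM : 4 * M * t <= e / 2 by nra.
have t1 : modulus (t%:C : Cplx R) < 1 by rewrite modR ?ltW //; lra.
have /cvg_modulusP/cvgr0Pnorm_lt/(_ (e / 2)) h := hd _ (RC0 _ t0) t1.
have {h} [N _ hN] : \forall n \near \oo, `|modulus
    (\sum_(0 <= k < n) d k * (t%:C : Cplx R) ^+ k - 0)| < e / 2 by apply: h; lra.
have {}hN := hN N.+1 (leqnSn N).
rewrite /= subr0 ger0_norm ?modulus_ge0 // in hN.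
have tail : modulus (\sum_(0 <= k < N) d k.+1 * (t%:C : Cplx R) ^+ k.+1) <= e / 2.
  apply: (@le_trans _ _ (2 * M * t * \sum_(0 <= k < N) (2 * t) ^+ k)).
    rewrite (le_trans (modulus_sum _ _)) // mulr_sumr; apply: ler_sum => k _.
    rewrite modulusM modulusX modR ?(ltW t0) //.
    have -> : 2 * M * t * (2 * t) ^+ k = M * 2 ^+ k.+1 * t ^+ k.+1.
      by rewrite exprMn !exprS; ring.
    by rewrite ler_wpM2r // exprn_ge0 // ltW.
  apply: le_trans tM; have -> : 4 * M * t = 2 * M * t * 2 by ring.
  have K0 : 0 <= 2 * M * t by apply: mulr_ge0 (ltW t0); apply: mulr_ge0.
  rewrite ler_wpM2l //.
  have t2 : 0 <= 2 * t < 1 by apply/andP; split; lra.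
  apply: le_trans (geometric_sum_le N t2) _.
  by rewrite -[leRHS]invrK lef_pV2 ?posrE; lra.
move: hN; rewrite big_nat_recl //= expr0 mulr1; move: tail.
set S := \sum_(0 <= i < N) _ => tail hN.
have := modulusD (d 0%N + S) (- S); rewrite addrK modulusN; lra.
Qed.

Lemma power_series_unique0 (R : realType) (d : nat -> Cplx R) :
  (forall x : Cplx R, modulus x < 1 ->
    (fun N : nat => \sum_(0 <= n < N) d n * x ^+ n) @ \oo --> (0 : Cplx R)) ->
  forall n, d n = 0.
Proof.
move=> hd n.
have {}hd x : x != 0 -> modulus x < 1 ->
    (fun N : nat => \sum_(0 <= n < N) d n * x ^+ n) @ \oo --> (0 : Cplx R).
  by move=> _; exact: hd.
elim: n d hd => [|n IHn] d hd; first exact: power_series_head_eq0.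
apply: (IHn (fun k => d k.+1)) => x x0 x1.
have d0 := power_series_head_eq0 hd.
have h := hd x x0 x1; rewrite -cvg_shiftS in h.
have := cvgnC_mul (@cvgnC_cst R x^-1) h; rewrite mulr0.
apply: cvg_trans; apply: near_eq_cvg; near=> N => /=.
rewrite big_nat_recl //= d0 mul0r add0r mulr_sumr; apply: eq_bigr => k _.
by rewrite exprS; field.
Unshelve. all: by end_near. Qed.

(** * Fifth roots of unity and sections of power series *)

Lemma sum_multiples_of_5 (V : nmodType) (v : nat -> V) N :
  (forall n, ~~ (5 %| n)%N -> v n = 0) ->
  \sum_(0 <= n < 5 * N) v n = \sum_(0 <= n < N) v (5 * n)%N.
Proof.
move=> v0; elim: N => [|N IHN]; first by rewrite muln0 !big_nil.
rewrite [RHS]big_nat_recr //= -IHN.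
have -> : (5 * N.+1 = (5 * N).+4.+1)%N by lia.
by rewrite !big_nat_recr //= ![v _.+1]v0 ?addr0 //; lia.
Qed.

(** A root of [z^4 + z^3 + z^2 + z + 1], which takes the value [5] at [1]. *)
Lemma fifth_root_of_unity (R : realType) :
  exists2 z : Cplx R, z ^+ 5 = 1 & z != 1.
Proof.
have [z zE] := @solve_monicpoly R[i] 4 (fun=> -1) isT.
rewrite !big_ord_recl big_ord0 /= in zE.
have z4 : z ^+ 4 + z ^+ 3 + z ^+ 2 + z + 1 = 0.
  by rewrite zE /bump /=; ring.
exists (z : Cplx R).
  have : (z ^+ 5 - 1 : R[i]) = 0.
    transitivity ((z - 1) * (z ^+ 4 + z ^+ 3 + z ^+ 2 + z + 1)); first by ring.
    by rewrite z4 mulr0.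
  by move/eqP; rewrite subr_eq0 => /eqP.
apply/eqP => z1; move: z4; rewrite z1 !expr1n => /eqP.
have -> : 1 + 1 + 1 + 1 + 1 = 5%:R :> R[i] by ring.
by rewrite pnatr_eq0.
Qed.

Lemma fifth_root (R : realType) (q : Cplx R) : exists x : Cplx R, x ^+ 5 = q.
Proof. by exists (5.-root (q : R[i])); exact: rootCK. Qed.

Lemma modulus_fifth_root (R : realType) (x : Cplx R) :
  (modulus (x ^+ 5) < 1) = (modulus x < 1).
Proof.
by rewrite modulusX -[ltRHS](expr1n _ 5) ltr_pXn2r // nnegrE ?modulus_ge0.
Qed.

Lemma fifth_root_expn_neq1 (R : realType) (z : Cplx R) n :
  z ^+ 5 = 1 -> z != 1 -> ~~ (5 %| n)%N -> z ^+ n != 1.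
Proof.
move=> z5 z1 n5.
have -> : z ^+ n = z ^+ (n %% 5).
  by rewrite {1}(divn_eq n 5) exprD mulnC exprM z5 expr1n mul1r.
apply: contra z1 => /eqP; move: n5; rewrite /dvdn.
have : (n %% 5 < 5)%N by rewrite ltn_mod.
case: (n %% 5)%N => [|[|[|[|[|]]]]] // _ _ zr.
- by rewrite -[z]expr1 zr.
- have : z ^+ 2 * z ^+ 2 * z = z ^+ 5 by rewrite -exprD -exprSr.
  by rewrite zr z5 !mul1r => ->.
- have : z ^+ 3 * z ^+ 3 = z ^+ 5 * z by rewrite -exprD -exprSr.
  by rewrite zr z5 !mul1r => <-.
- by rewrite -[z]mul1r -{1}zr -exprSr z5.
Qed.

Lemma fifth_root_power_sum (R : realType) (z : Cplx R) n :
  z ^+ 5 = 1 -> z != 1 ->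
  \sum_(k < 5) (z ^+ n) ^+ k = if (5 %| n)%N then 5%:R else 0.
Proof.
move=> z5 z1; case: ifPn => [/dvdnP[m ->]|n5].
  under eq_bigr => k _ do rewrite -exprM mulnAC mulnC exprM z5 expr1n.
  by rewrite sumr_const card_ord.
have := subrX1 (z ^+ n) 5; rewrite -exprM mulnC exprM z5 expr1n subrr => /esym/eqP.
by rewrite mulf_eq0 subr_eq0 (negPf (fifth_root_expn_neq1 z5 z1 n5)) => /eqP.
Qed.

(* The partial sums of [u] at the five points [z ^+ k * x] add up to five times
   those of the section [n |-> u (5 * n)] at [x ^+ 5]. *)
Lemma cvg_power_series_section5 (R : realType) (u : nat -> Cplx R) :
  (forall x : Cplx R, modulus x < 1 ->
    cvgn (fun N : nat => \sum_(0 <= n < N) u n * x ^+ n)) ->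
  forall q : Cplx R, modulus q < 1 ->
    cvgn (fun N : nat => \sum_(0 <= n < N) u (5 * n)%N * q ^+ n).
Proof.
move=> hu q q1.
have [z z5 z1] := fifth_root_of_unity R.
have mz : modulus z = 1.
  apply/eqP; rewrite -(@pexpr_eq1 _ _ 5) ?modulus_ge0 //.
  by rewrite -modulusX z5 modulus1.
have [x xE] := fifth_root q.
have x1 : modulus x < 1 by rewrite -modulus_fifth_root xE.
pose s k (N : nat) := \sum_(0 <= n < N) u n * (z ^+ k * x) ^+ n.
have hs k : cvgn (s k).
  by apply: hu; rewrite modulusM modulusX mz expr1n mul1r.
have h5 m : (fun N => \sum_(k < m) s k (5 * N)%N) @ \oo --> \sum_(k < m) limn (s k).
  elim: m => [|m IHm].
    rewrite big_ord0; under eq_fun do rewrite big_ord0.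
    exact: cvgnC_cst.
  rewrite big_ord_recr; under eq_fun do rewrite big_ord_recr.
  have hm : (fun N => s m (5 * N)%N) @ \oo --> limn (s m).
    exact: (cvg_comp _ _ (cvgn_muln (isT : (0 < 5)%N)) (hs m)).
  exact: (cvgnC_add IHm hm).
apply/cvg_ex; exists (5%:R^-1 * \sum_(k < 5) limn (s k)).
have := cvgnC_mul (@cvgnC_cst R 5%:R^-1) (h5 5%N).
apply: cvg_trans; apply: near_eq_cvg; near=> N => /=.
have five0 : 5%:R != 0 :> Cplx R by rewrite pnatr_eq0.
apply: (mulfI five0); rewrite mulrA divff // mul1r.
rewrite /s exchange_big /=.
transitivity (\sum_(0 <= n < 5 * N) u n * x ^+ n * (if (5 %| n)%N then 5%:R else 0)).
  apply: eq_bigr => n _; rewrite -(fifth_root_power_sum n z5 z1) mulr_sumr.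
  by apply: eq_bigr => k _; rewrite exprMn -!exprM mulnC; ring.
rewrite sum_multiples_of_5; last by move=> n /negPf ->; rewrite mulr0.
rewrite mulr_sumr; apply: eq_bigr => n _.
by rewrite dvdn_mulr // -xE -exprM; ring.
Unshelve. all: by end_near. Qed.

(** * The 5-dissection of [sum_n (b_n - a_(n-2)) q^n] *)

Theorem theorem8 (R : realType) (a : int -> int) (b : nat -> int)
  (a_neg : forall n : int, n < 0 -> a n = 0)
  (a_def : forall q : Cplx R, `|q| < 1 ->
    (fun N : nat => \sum_(0 <= n < N) (a n%:Z)%:~R * q ^+ n) @ \oo -->
      qpochs [:: - q; - q ^+ 4] (q ^+ 5)
        * qpochs [:: q; q ^+ 9] (q ^+ 10) ^+ 3)
  (b_def : forall q : Cplx R, `|q| < 1 ->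
    (fun N : nat => \sum_(0 <= n < N) (b n)%:~R * q ^+ n) @ \oo -->
      qpochs [:: - q ^+ 2; - q ^+ 3] (q ^+ 5)
        * qpochs [:: q ^+ 3; q ^+ 7] (q ^+ 10) ^+ 3) :
  (forall q : Cplx R, `|q| < 1 ->
    let B := fun N : nat => \sum_(0 <= n < N) (b (5 * n)%N)%:~R * q ^+ n in
    let A := fun N : nat =>
      \sum_(1 <= n < N) (a (5 * n%:Z - 2))%:~R * q ^+ n in
    [/\ cvgn B, cvgn A
      & limn B - limn A = eulerf 1 q ^+ 4 / eulerf 2 q ^+ 4])
  /\ (forall n : nat,
    [/\ b (5 * n + 1)%N = a (5 * n%:Z - 1),
        b (5 * n + 2)%N = a (5 * n%:Z),
        b (5 * n + 3)%N = a (5 * n%:Z + 1)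
      & b (5 * n + 4)%N = a (5 * n%:Z + 2)]).
Proof.
pose a' n := a (n%:Z - 2%:Z); pose c n := b n - a' n.
pose F (y : Cplx R) := eulerf 1 y ^+ 4 / eulerf 2 y ^+ 4.
have a'_cvg (x : Cplx R) : modulus x < 1 ->
    (fun N : nat => \sum_(0 <= n < N) (a' n)%:~R * x ^+ n) @ \oo -->
    x ^+ 2 * (qpochs [:: - x; - x ^+ 4] (x ^+ 5)
        * qpochs [:: x; x ^+ 9] (x ^+ 10) ^+ 3).
  rewrite -modulus_lt1 => x1; rewrite -(cvg_shiftn 2).
  have := cvgnC_mul (@cvgnC_cst R (x ^+ 2)) (a_def x x1).
  apply: cvg_trans; apply: near_eq_cvg; near=> N => /=.
  (* The two leading terms vanish because [a] is zero at [-2] and [-1]. *)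
  rewrite addn2 !big_nat_recl // /a' !a_neg // !mul0r !add0r mulr_sumr.
  apply: eq_bigr => n _.
  have -> : n.+2%:Z - 2%:Z = n%:Z by lia.
  by rewrite !exprS; ring.
have b_cvg (x : Cplx R) : modulus x < 1 ->
    (fun N : nat => \sum_(0 <= n < N) (b n)%:~R * x ^+ n) @ \oo -->
    qpochs [:: - x ^+ 2; - x ^+ 3] (x ^+ 5)
        * qpochs [:: x ^+ 3; x ^+ 7] (x ^+ 10) ^+ 3.
  by rewrite -modulus_lt1; exact: b_def.
have c_cvg (x : Cplx R) : modulus x < 1 ->
    (fun N : nat => \sum_(0 <= n < N) (c n)%:~R * x ^+ n) @ \oo --> F (x ^+ 5).
  move=> x1; rewrite /F -product_identity //.
  have := cvgnC_sub (b_cvg x x1) (a'_cvg x x1).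
  apply: cvg_trans; apply: near_eq_cvg; near=> N => /=.
  rewrite -sumrB; apply: eq_bigr => n _.
  by rewrite /c rmorphB mulrBl.
have [z z5 z1] := fifth_root_of_unity R.
have mz : modulus z = 1.
  apply/eqP; rewrite -(@pexpr_eq1 _ _ 5) ?modulus_ge0 //.
  by rewrite -modulusX z5 modulus1.
have c0 n : ~~ (5 %| n)%N -> c n = 0.
  move=> n5.
  have : (c n)%:~R * (z ^+ n - 1) = 0 :> Cplx R.
    (* Replacing [x] by [z * x] leaves [F (x ^+ 5)] unchanged, so the series with coefficients
       [c_n (z^n - 1)] sums to zero. *)
    apply: (@power_series_unique0 R (fun n => (c n)%:~R * (z ^+ n - 1))) => x x1.
    have zx1 : modulus (z * x) < 1 by rewrite modulusM mz mul1r.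
    have := cvgnC_sub (c_cvg _ zx1) (c_cvg _ x1).
    rewrite exprMn z5 mul1r subrr.
    apply: cvg_trans; apply: near_eq_cvg; near=> N => /=.
    rewrite -sumrB; apply: eq_bigr => k _.
    by rewrite exprMn; ring.
  move/eqP; rewrite mulf_eq0 subr_eq0 (negPf (fifth_root_expn_neq1 z5 z1 n5)) orbF.
  by rewrite intr_eq0 => /eqP.
split; last first.
  move=> n.
  have h r : ~~ (5 %| 5 * n + r)%N -> b (5 * n + r)%N = a ((5 * n + r)%N%:Z - 2%:Z).
    by move=> /c0/eqP; rewrite subr_eq0 => /eqP.
  have n5 r : (0 < r < 5)%N -> ~~ (5 %| 5 * n + r)%N by lia.
  by split; rewrite h ?n5 //; congr (a _); lia.
move=> q; rewrite modulus_lt1 => q1 B A.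
(* Starting at [n = 0] instead of [1] only adds the term [a (-2) = 0]. *)
have AE : A = fun N => \sum_(0 <= n < N) (a' (5 * n)%N)%:~R * q ^+ n.
  apply/funext => -[|N]; first by rewrite /A !big_geq.
  rewrite /A [RHS]big_ltn // {1}/a' a_neg // mul0r add0r.
  by apply: eq_bigr => n _; rewrite /a' PoszM.
(* The series for [c] controls only the difference of [B] and [A]; their separate convergence comes
   from sectioning the series of [b] and [a']. *)
have cB : cvgn B.
  have h (x : Cplx R) : modulus x < 1 ->
      cvgn (fun N : nat => \sum_(0 <= n < N) (b n)%:~R * x ^+ n).
    by move=> x1; apply/cvg_ex; eexists; exact: b_cvg x1.
  exact: (@cvg_power_series_section5 R (fun n => (b n)%:~R) h q q1).
have cA : cvgn A.
  have h (x : Cplx R) : modulus x < 1 ->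
      cvgn (fun N : nat => \sum_(0 <= n < N) (a' n)%:~R * x ^+ n).
    by move=> x1; apply/cvg_ex; eexists; exact: a'_cvg x1.
  rewrite AE; exact: (@cvg_power_series_section5 R (fun n => (a' n)%:~R) h q q1).
split=> //.
(* At a fifth root [x] of [q], the first [5N] terms of the series of [c] reduce to the multiples of
   [5], which form [B N - A N]. *)
have [x xE] := fifth_root q.
have x1 : modulus x < 1 by rewrite -modulus_fifth_root xE.
have h := cvg_comp _ _ (cvgn_muln (isT : (0 < 5)%N)) (c_cvg x x1).
rewrite xE in h; apply: cvgn_lim_unique h.
have := cvgnC_sub cB cA.
apply: cvg_trans; apply: near_eq_cvg; near=> N => /=.
rewrite sum_multiples_of_5; last by move=> n /c0 ->; rewrite mul0r.
rewrite AE -sumrB; apply: eq_bigr => n _.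
by rewrite exprM xE /c rmorphB mulrBl.
Unshelve. all: by end_near. Qed.
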